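(* Let $a>1$, $n\ge1$, $g\in L^2(\mathbb{R})$ and $x\in\mathbb{R}$. Let $S^{g,x}_n(t,a)=F_n(t,a)\,g(t-x)$ and $\omega_j=1-\frac{2j}{n}$. Then for $(u,\eta)\in\mathbb{R}^2$, $$\mathcal{Z}(S^{g,x}_n)(u,\eta)=\sum_{j=0}^nC_j(n,a)\,e^{i\omega_ju}\,\mathcal{Z}(g)(u-x,\eta-\omega_j).$$
   Context: The Zak transform of a (suitable) function $f:\mathbb{R}\to\mathbb{C}$ is $\mathcal{Z}(f)(u,\eta)=\sum_{k\in\mathbb{Z}}f(u-k)e^{ik\eta}$, $(u,\eta)\in\mathbb{R}^2$. For $f\in L^2(\mathbb{R})$ the series in $\eta$ converges in $L^2$ on every interval of length $2\pi$ for almost every $u$, and identities between Zak transforms of $L^2$ functions are understood for almost every $(u,\eta)$. The superoscillating sequence is $F_n(t,a)=\sum_{j=0}^nC_j(n,a)e^{i(1-2j/n)t}$ with $C_j(n,a)=\binom{n}{j}\left(\frac{1+a}{2}\right)^{n-j}\left(\frac{1-a}{2}\right)^j$. *)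

(* Defs.v *)
From HB Require Import structures.
From mathcomp Require Import all_boot all_order all_algebra.
From mathcomp Require Import all_classical all_reals all_analysis.
From mathcomp Require Import complex.
Set Implicit Arguments.
Unset Strict Implicit.
Unset Printing Implicit Defensive.
Import Order.TTheory GRing.Theory Num.Theory.
Import numFieldNormedType.Exports.
Local Open Scope classical_set_scope.
Local Open Scope ring_scope.
Local Open Scope complex_scope.

Definition expi {R : realType} (t : R) : R[i] := cos t +i* sin t.

(* R[i] carries no measurable structure in the library: measurability of a
   complex-valued function is that of its real and imaginary parts. *)
Definition cmeasurable {R : realType} {d : measure_display}
    {T : measurableType d} (f : T -> R[i]) : Prop :=
  measurable_fun setT (fun x => complex.Re (f x)) /\
  measurable_fun setT (fun x => complex.Im (f x)).

Definition sqmod {R : realType} (z : R[i]) : R := ComplexField.Normc.normc z ^+ 2.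

(* f is a (Borel) representative of an element of L^2(R; C). *)
Definition L2 {R : realType} (f : R -> R[i]) : Prop :=
  cmeasurable (f : measurableTypeR R -> R[i]) /\
  (\int[lebesgue_measure]_x (sqmod (f x))%:E < +oo)%E.

Definition zak_term {R : realType} (f : R -> R[i]) (u eta : R) (k : int) : R[i] :=
  f (u - k%:~R) * expi (k%:~R * eta).

(* The sum over - M <= k < N; note that Negz k is - (k + 1). *)
Definition zak_partial {R : realType} (f : R -> R[i]) (M N : nat) (u eta : R) : R[i] :=
  \sum_(k < N) zak_term f u eta (Posz k) + \sum_(k < M) zak_term f u eta (Negz k).

(* Z is jointly measurable and, for almost every u, the series defining the
   Zak transform of f at u converges to Z u in L^2 of every interval of
   length 2 * pi.  Joint measurability makes Z unique up to a null set of
   the plane, by Tonelli; L^2 limits chosen separately for each u need not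
   agree almost everywhere in (u, eta). *)
Definition is_zak {R : realType} (f : R -> R[i]) (Z : R -> R -> R[i]) : Prop :=
  cmeasurable
    (fun p : measurableTypeR R * measurableTypeR R => Z p.1 p.2) /\
  {ae @lebesgue_measure R, forall u, forall c : R,
    (\int[lebesgue_measure]_(eta in `[c, (c + 2 * pi)%R])
       (sqmod (zak_partial f mn.1 mn.2 u eta - Z u eta))%:E)%E
      @[mn --> (\oo, \oo)] --> 0%E}.

(* For f in L^2 a function Z with is_zak f Z exists and is unique almost
   everywhere; the default value 0 only concerns other f. *)
Definition zak {R : realType} (f : R -> R[i]) : R -> R -> R[i] :=
  xget (fun _ _ => 0) [set Z | is_zak f Z].

Definition superosc_coef {R : realType} (n : nat) (a : R) (j : nat) : R :=
  'C(n, j)%:R * ((1 + a) / 2) ^+ (n - j) * ((1 - a) / 2) ^+ j.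

Definition superosc_freq {R : realType} (n j : nat) : R := 1 - 2 * j%:R / n%:R.

Definition superosc {R : realType} (n : nat) (a t : R) : R[i] :=
  \sum_(j < n.+1) (superosc_coef n a j)%:C * expi (superosc_freq n j * t).

Definition superosc_window {R : realType} (n : nat) (a : R) (g : R -> R[i])
    (x t : R) : R[i] :=
  superosc n a t * g (t - x).

(* Main.v *)
Require Import Defs.
From HB Require Import structures.
From mathcomp Require Import all_boot all_order all_algebra.
From mathcomp Require Import all_classical all_reals all_analysis.
From mathcomp Require Import complex.
From mathcomp Require Import measurable_realfun.
From mathcomp Require Import ring lra zify.
Set Implicit Arguments.
Unset Strict Implicit.
Unset Printing Implicit Defensive.
Import Order.TTheory GRing.Theory Num.Theory.
Import numFieldNormedType.Exports.
Local Open Scope classical_set_scope.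
Local Open Scope ring_scope.
Local Open Scope complex_scope.

(** For a finite sum of samples the formula is an algebraic identity: since
    [expi (w * (u - k)) * expi (k * eta) = expi (w * u) * expi (k * (eta - w))],
    multiplying [g (t - x)] by a single exponential of frequency [w] modulates
    the Zak series by [expi (w * u)] and translates it by [(x, w)], and a
    superoscillating sequence is a linear combination of such exponentials
    ([zak_partial_superosc]).  What has to be justified is the passage to the
    limit in the sense of [is_zak], together with the fact that the function
    chosen by [zak] is the expected one.

    The identity passes to the limit because translating the variable [eta]
    carries an interval of length [2 * pi] to another one, and because the
    exceptional null set of abscissas [u] may be translated by [x]: if [Z] is
    a Zak transform of [g], then the right-hand side built from [Z] is a Zak
    transform of the modulated window ([is_zak_superosc]).

    Zak transforms are unique almost everywhere in the plane
    ([is_zak_unique]): for almost every [u], two of them are [L^2] limits of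
    the same partial sums on every interval of length [2 * pi], hence agree
    for almost every [eta]; joint measurability and Tonelli's theorem
    conclude.

    It remains to see that a square integrable [g] has a Zak transform
    ([is_zak_zak_lim]); otherwise [zak g] would be a default value with no
    relation to its counterpart for the modulated window.  By Tonelli's
    theorem, the samples [g (u - k)] are square summable for almost every [u],
    and Parseval's identity then makes the partial sums Cauchy in [L^2] of
    every period, with an explicit control by the tails [zak_tail].  The
    limit has to be chosen jointly measurably in [(u, eta)].  For each [i], let
    [N] be the first index whose tail at [u] is at most [(1 / 4) ^ i]
    ([zak_index]); it is a measurable function of [u].  As [i] varies, the
    partial sums of order [N] converge geometrically in [L^2], hence pointwise
    for almost every [eta], and their pointwise limit [zak_lim], written with
    limits superior, is measurable in both variables.  Fatou's lemma shows
    that it is also the [L^2] limit of all the partial sums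
    ([zak_partial_lim_dist]). *)

(** * Complex moduli and measurability *)

Section basics.
Context {R : realType}.
Implicit Types (z w : R[i]) (t : R).

Lemma sqmodE z : sqmod z = complex.Re z ^+ 2 + complex.Im z ^+ 2.
Proof.
by case: z => a b; rewrite /sqmod /= sqr_sqrtr// addr_ge0// sqr_ge0.
Qed.

Lemma sqmod_ge0 z : 0 <= sqmod z.
Proof. exact: sqr_ge0. Qed.

Lemma sqmod_eq0 z : sqmod z = 0 -> z = 0.
Proof.
rewrite sqmodE; case: z => a b /= /eqP.
by rewrite paddr_eq0 ?sqr_ge0// !sqrf_eq0 => /andP[/eqP-> /eqP->].
Qed.

Lemma sqmodM z w : sqmod (z * w) = sqmod z * sqmod w.
Proof. by rewrite /sqmod ComplexField.Normc.normcM exprMn. Qed.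

Lemma sqmodN z : sqmod (- z) = sqmod z.
Proof. by rewrite !sqmodE; case: z => a b /=; rewrite !sqrrN. Qed.

Lemma sqmod0 : sqmod (0 : R[i]) = 0.
Proof. by rewrite sqmodE /= expr0n addr0. Qed.

Lemma expiD t t' : expi (t + t') = expi t * expi t'.
Proof.
by rewrite /expi cosD sinD; apply/eqP; rewrite eq_complex /= addrC eqxx/= addrC eqxx.
Qed.

Lemma sqmodD_le z w : sqmod (z + w) <= 2 * (sqmod z + sqmod w).
Proof.
rewrite !sqmodE; case: z w => a b [c d] /=.
have := sqr_ge0 (a - c); have := sqr_ge0 (b - d); nra.
Qed.

(** Any constant depending on [n] alone suffices below; this one comes from
    iterating [sqmodD_le]. *)
Lemma sqmod_sum_le n (F : 'I_n -> R[i]) :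
  sqmod (\sum_(j < n) F j) <= 2 ^+ n * \sum_(j < n) sqmod (F j).
Proof.
elim: n F => [|n IH] F; first by rewrite !big_ord0 sqmod0 mulr0.
rewrite !big_ord_recr/= (le_trans (sqmodD_le _ _))// exprS -mulrA ler_pM2l//.
rewrite mulrDr lerD//; apply: ler_peMl; first exact: sqmod_ge0.
by rewrite exprn_ege1// ler1n.
Qed.

Lemma ReD z w : complex.Re (z + w) = complex.Re z + complex.Re w.
Proof. by case: z w => a b [c d]. Qed.
Lemma ImD z w : complex.Im (z + w) = complex.Im z + complex.Im w.
Proof. by case: z w => a b [c d]. Qed.
Lemma ReN z : complex.Re (- z) = - complex.Re z.
Proof. by case: z. Qed.
Lemma ImN z : complex.Im (- z) = - complex.Im z.
Proof. by case: z. Qed.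
Lemma ReM z w : complex.Re (z * w) =
  complex.Re z * complex.Re w - complex.Im z * complex.Im w.
Proof. by case: z w => a b [c d]. Qed.
Lemma ImM z w : complex.Im (z * w) =
  complex.Re z * complex.Im w + complex.Im z * complex.Re w.
Proof. by case: z w => a b [c d]. Qed.

End basics.

Section cmeasurable.
Context {R : realType} d (T : measurableType d).
Implicit Types (f g : T -> R[i]).

Lemma cmeasurable_cst (z : R[i]) : cmeasurable (fun _ : T => z).
Proof. by split; exact: measurable_cst. Qed.

Lemma cmeasurableD f g : cmeasurable f -> cmeasurable g ->
  cmeasurable (fun x => f x + g x).
Proof.
move=> [f1 f2] [g1 g2]; split.
- by under eq_fun do rewrite ReD; exact: measurable_funD.
- by under eq_fun do rewrite ImD; exact: measurable_funD.
Qed.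

Lemma cmeasurableN f : cmeasurable f -> cmeasurable (fun x => - f x).
Proof.
move=> [f1 f2]; split.
- by under eq_fun do rewrite ReN; exact: measurableT_comp.
- by under eq_fun do rewrite ImN; exact: measurableT_comp.
Qed.

Lemma cmeasurableB f g : cmeasurable f -> cmeasurable g ->
  cmeasurable (fun x => f x - g x).
Proof. by move=> mf mg; apply: cmeasurableD => //; exact: cmeasurableN. Qed.

Lemma cmeasurableM f g : cmeasurable f -> cmeasurable g ->
  cmeasurable (fun x => f x * g x).
Proof.
move=> [f1 f2] [g1 g2]; split.
- by under eq_fun do rewrite ReM; apply: measurable_funB; exact: measurable_funM.
- by under eq_fun do rewrite ImM; apply: measurable_funD; exact: measurable_funM.
Qed.

Lemma cmeasurable_sum I (s : seq I) (F : I -> T -> R[i]) :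
  (forall i, cmeasurable (F i)) -> cmeasurable (fun x => \sum_(i <- s) F i x).
Proof.
move=> mF; elim: s => [|i s IH].
  by under eq_fun do rewrite big_nil; exact: cmeasurable_cst.
by under eq_fun do rewrite big_cons; exact: cmeasurableD.
Qed.

Lemma cmeasurable_expi (h : T -> measurableTypeR R) :
  measurable_fun setT h -> cmeasurable (fun x => expi (h x)).
Proof.
move=> mh; split => /=.
- apply: (measurableT_comp _ mh); exact: (continuous_measurable_fun (@continuous_cos R)).
- apply: (measurableT_comp _ mh); exact: (continuous_measurable_fun (@continuous_sin R)).
Qed.

Lemma measurable_sqmod f : cmeasurable f -> measurable_fun setT (fun x => sqmod (f x)).
Proof.
move=> [f1 f2]; under eq_fun do rewrite sqmodE.
by apply: measurable_funD; exact: measurable_funX.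
Qed.

Lemma measurable_esqmod f : cmeasurable f ->
  measurable_fun setT (fun x => (sqmod (f x))%:E).
Proof. by move=> mf; apply/measurable_EFinP; exact: measurable_sqmod. Qed.

End cmeasurable.

Lemma cmeasurable_comp {R : realType} d (T : measurableType d) d' (T' : measurableType d')
    (f : T -> R[i]) (h : T' -> T) :
  cmeasurable f -> measurable_fun setT h -> cmeasurable (fun x => f (h x)).
Proof.
by move=> [f1 f2] mh; split; [exact: measurableT_comp f1 mh|exact: measurableT_comp f2 mh].
Qed.

(** * Translation invariance of the Lebesgue measure *)

Section translation.
Context {R : realType}.
Local Notation mu := (@lebesgue_measure R).
Local Notation mR := (measurableTypeR R).

Lemma measurable_shift (s : R) : measurable_fun [set: mR] (fun x : mR => x - s : mR).
Proof. by apply: measurable_funB => //; exact: measurable_cst. Qed.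

(** The image of the Lebesgue measure under a translation agrees with it on
    half-open intervals, and these determine it. *)
Lemma lebesgue_measure_shift (s : R) (A : set mR) : measurable A ->
  mu ((fun x : mR => x - s : mR) @^-1` A) = mu A.
Proof.
move=> mA; apply/esym.
pose f := [the {mfun mR >-> mR} of mfun_Sub (mem_set (measurable_shift s))].
apply: (@lebesgue_measure_unique R (pushforward mu f)) => //= X [[a b] /= _ <-].
rewrite /pushforward.
have -> : f @^-1` `]a, b]%classic = `]a + s, b + s]%classic.
  by apply/seteqP; split=> y /=; rewrite !in_itv/= ltrBrDr lerBlDr.
rewrite !lebesgue_measure_itv/= !lte_fin ltrD2r; case: ifP => // _.
by rewrite -!EFinD; congr EFin; ring.
Qed.

Lemma ge0_integral_shift (s : R) (D : set mR) (f : mR -> \bar R) :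
  measurable D -> measurable_fun setT f -> (forall x, 0 <= f x)%E ->
  (\int[mu]_(x in (fun x : mR => (x - s)%R : mR) @^-1` D) f (x - s)%R =
   \int[mu]_(x in D) f x)%E.
Proof.
move=> mD mf f0.
transitivity (\int[pushforward mu (fun x : mR => (x - s)%R : mR)]_(y in D) f y)%E.
  rewrite ge0_integral_pushforward//.
  - exact: measurable_shift.
  - exact: measurable_funTS.
apply: eq_measure_integral => [|ms A mA _]; first exact: measurable_shift.
exact: lebesgue_measure_shift.
Qed.

Lemma ge0_integral_itv_shift (s a b : R) (f : mR -> \bar R) :
  measurable_fun setT f -> (forall x, 0 <= f x)%E ->
  (\int[mu]_(x in `[a, b]) f (x - s)%R =
   \int[mu]_(x in `[(a - s)%R, (b - s)%R]) f x)%E.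
Proof.
move=> mf f0; rewrite -[RHS](ge0_integral_shift s)//; congr (integral _ _ _).
by apply/seteqP; split=> y /=; rewrite !in_itv/= !lerD2r.
Qed.

Lemma ae_shift (s : R) (P : R -> Prop) :
  {ae mu, forall u, P u} -> {ae mu, forall u, P (u - s)}.
Proof.
case=> N [mN N0 PN]; exists ((fun x : mR => x - s : mR) @^-1` N); split.
- by rewrite -[X in measurable X]setTI; exact: measurable_shift.
- by rewrite -N0; exact: lebesgue_measure_shift.
- by move=> u /= nPu; exact: PN.
Qed.

End translation.

(** * Parseval's identity for trigonometric polynomials *)

Section parseval.
Context {R : realType}.
Local Notation mu := (@lebesgue_measure R).

(** The fundamental theorem of calculus with global hypotheses, which avoids
    one-sided limits at the end points. *)
Lemma integral_derive (H h : R -> R) (c d : R) : c < d ->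
  (forall x : R, is_derive x 1 H (h x)) -> continuous h ->
  (\int[mu]_(x in `[c, d]) (h x)%:E)%E = (H d - H c)%:E.
Proof.
move=> cd dH ch.
have cH : continuous H.
  by move=> x; apply/differentiable_continuous/derivable1_diffP; case: (dH x).
rewrite (@continuous_FTC2 R h H)//.
- exact: continuous_subspaceT.
- split.
  + by move=> x _; case: (dH x).
  + exact: cvg_at_right_filter (cH c).
  + exact: cvg_at_left_filter (cH d).
- by move=> x _; rewrite derive1E; case: (dH x).
Qed.

Lemma is_derive_bigsum (I : Type) (s : seq I) (F : I -> R -> R) (f : I -> R) (x : R) :
  (forall i, is_derive x 1 (F i) (f i)) ->
  is_derive x 1 (fun y => \sum_(i <- s) F i y) (\sum_(i <- s) f i).
Proof.
move=> dF; elim: s => [|i s IH].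
  rewrite big_nil (_ : (fun _ => _) = cst 0); first exact: is_derive_cst.
  by apply/funext => y; rewrite big_nil.
rewrite big_cons (_ : (fun _ => _) = F i + (fun y => \sum_(i <- s) F i y)).
  exact: is_deriveD.
by apply/funext => y; rewrite big_cons.
Qed.

(** The real inner product of the plane, that is the real part of
    [z * w^*]; its quadratic form is [sqmod]. *)
Definition cdot (z w : R[i]) : R :=
  complex.Re z * complex.Re w + complex.Im z * complex.Im w.

Lemma cdot_suml (I : Type) (s : seq I) (F : I -> R[i]) w :
  cdot (\sum_(i <- s) F i) w = \sum_(i <- s) cdot (F i) w.
Proof.
elim: s => [|i s IH]; first by rewrite !big_nil /cdot /= !mul0r addr0.
by rewrite !big_cons -IH /cdot ReD ImD; ring.
Qed.

Lemma cdot_sumr (I : Type) (s : seq I) (F : I -> R[i]) w :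
  cdot w (\sum_(i <- s) F i) = \sum_(i <- s) cdot w (F i).
Proof.
elim: s => [|i s IH]; first by rewrite !big_nil /cdot /= !mulr0 addr0.
by rewrite !big_cons -IH /cdot ReD ImD; ring.
Qed.

Lemma cdot_expi (z w : R[i]) (s t : R) :
  cdot (z * expi s) (w * expi t) =
  cdot z w * cos (s - t) - cdot z ('i%C * w) * sin (s - t).
Proof.
rewrite cosB sinB /cdot /expi; case: z w => a b [p q] /=.
ring.
Qed.

Lemma is_derive_lin (m x : R) : is_derive x 1 (fun y : R => m * y) m.
Proof.
rewrite (_ : (fun _ => _) = m \*: id) //.
by apply: is_derive_eq; rewrite /GRing.scale /= mulr1.
Qed.

Lemma is_derive_trig (a b m x : R) : m != 0 ->
  is_derive x 1 (fun y => (a * sin (m * y) + b * cos (m * y)) / m)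
    (a * cos (m * x) - b * sin (m * x)).
Proof.
move=> m0.
have dl := is_derive_lin m x.
have ds := @is_derive1_comp _ sin _ x _ _ (is_derive_sin (m * x)) dl.
have dc := @is_derive1_comp _ cos _ x _ _ (is_derive_cos (m * x)) dl.
have := is_deriveZ (m^-1) (is_deriveD (is_deriveZ a ds) (is_deriveZ b dc)).
rewrite (_ : _ \*: _ = (fun y => (a * sin (m * y) + b * cos (m * y)) / m)); last first.
  by apply/funext => y /=; rewrite mulrC.
by move=> /is_derive_eq; apply; rewrite /GRing.scale/=; field.
Qed.

Lemma sin_periodz (k : int) (x : R) : sin (x + k%:~R * (2 * pi)) = sin x.
Proof.
have P n y : sin (y + n%:R * (2 * pi)) = sin y :> R.
  by rewrite !mulr_natl periodicn//; exact: sinD2pi.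
case: k => n; first by rewrite -pmulrn P.
by rewrite NegzE mulrNz -pmulrn mulNr -[LHS](P n.+1) subrK.
Qed.

Lemma cos_periodz (k : int) (x : R) : cos (x + k%:~R * (2 * pi)) = cos x.
Proof.
have P n y : cos (y + n%:R * (2 * pi)) = cos y :> R.
  by rewrite !mulr_natl periodicn//; exact: cosD2pi.
case: k => n; first by rewrite -pmulrn P.
by rewrite NegzE mulrNz -pmulrn mulNr -[LHS](P n.+1) subrK.
Qed.

Lemma continuous_bigsum (I : Type) (s : seq I) (F : I -> R -> R) :
  (forall i, continuous (F i)) -> continuous (fun y => \sum_(i <- s) F i y).
Proof.
move=> cF; elim: s => [|i s IH].
  by under eq_fun do rewrite big_nil; move=> x; exact: cvg_cst.
by under eq_fun do rewrite big_cons; move=> x; apply: cvgD; [exact: cF|exact: IH].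
Qed.

(** Expanding [sqmod] of the sum gives a double sum of terms of frequency
    [k - l].  The antiderivative of an off-diagonal term is a combination of
    sines and cosines of nonzero integer frequency, hence takes the same value
    at [c] and [c + 2 * pi]; only the diagonal contributes. *)
Lemma parseval (c : R) (s : seq int) (a : int -> R[i]) : uniq s ->
  (\int[mu]_(x in `[c, (c + 2 * pi)%R])
      (sqmod (\sum_(k <- s) a k * expi (k%:~R * x)))%:E)%E =
  (2 * pi * \sum_(k <- s) sqmod (a k))%:E.
Proof.
move=> us.
pose al k l := cdot (a k) (a l).
pose be k l := cdot (a k) ('i%C * a l).
pose h k l x : R := al k l * cos ((k - l)%:~R * x) - be k l * sin ((k - l)%:~R * x).
pose H k l x : R := if k == l then al k l * x else
  (al k l * sin ((k - l)%:~R * x) + be k l * cos ((k - l)%:~R * x)) / (k - l)%:~R.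
have hE x : sqmod (\sum_(k <- s) a k * expi (k%:~R * x)) =
    \sum_(k <- s) \sum_(l <- s) h k l x.
  rewrite sqmodE !expr2 -/(cdot _ _) cdot_suml; apply: eq_bigr => k _.
  rewrite cdot_sumr; apply: eq_bigr => l _.
  by rewrite cdot_expi /h /al /be -mulrBl -intrB.
under eq_integral do rewrite hE.
have dH (k l : int) (x : R) : is_derive x 1 (H k l) (h k l x).
  rewrite /H /h; case: eqVneq => [->|kl].
    by rewrite subrr mul0r cos0 sin0 mulr1 mulr0 subr0; exact: is_derive_lin.
  by apply: is_derive_trig; rewrite intr_eq0 subr_eq0.
have dS (x : R) : is_derive x 1 (fun x => \sum_(k <- s) \sum_(l <- s) H k l x)
    (\sum_(k <- s) \sum_(l <- s) h k l x).
  by do 2!apply: is_derive_bigsum => ?; exact: dH.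
have cS : continuous (fun x => \sum_(k <- s) \sum_(l <- s) h k l x).
  do 2!apply: continuous_bigsum => ?; rewrite /h => x.
  have cl (m : R) : {for x, continuous (fun y : R => m * y)}.
    by apply: cvgM; [exact: cvg_cst|exact: cvg_id].
  apply: cvgB; apply: cvgM; (try exact: cvg_cst).
    by apply: (continuous_comp (cl _)); exact: continuous_cos.
  by apply: (continuous_comp (cl _)); exact: continuous_sin.
have cpi : c < c + 2 * pi by rewrite ltrDl mulr_gt0// pi_gt0.
rewrite (integral_derive cpi dS cS).
congr EFin; rewrite -sumrB mulr_sumr [LHS]big_seq_cond [RHS]big_seq_cond.
apply: eq_bigr => k; rewrite andbT => ks.
rewrite -sumrB (bigD1_seq k)//= big1 ?addr0.
  by rewrite /H eqxx -mulrBr addrAC subrr add0r /al mulrC sqmodE.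
move=> l lk; rewrite /H eq_sym (negbTE lk).
by rewrite (mulrDr _ c (2 * pi)) sin_periodz cos_periodz subrr.
Qed.

End parseval.

(** * Square summability along integer translates *)

Lemma ae_imply {R : realType} d (T : measurableType d)
    (mu : {measure set T -> \bar R}) (P Q : T -> Prop) :
  (forall x, P x -> Q x) -> {ae mu, forall x, P x} -> {ae mu, forall x, Q x}.
Proof. by move=> PQ; apply: filterS. Qed.

Lemma ae_imply2 {R : realType} d (T : measurableType d)
    (mu : {measure set T -> \bar R}) (P Q S : T -> Prop) :
  (forall x, P x -> Q x -> S x) ->
  {ae mu, forall x, P x} -> {ae mu, forall x, Q x} -> {ae mu, forall x, S x}.
Proof. by move=> PQS; apply: filterS2. Qed.

Lemma ae_forall_int {R : realType} d (T : measurableType d)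
    (mu : {measure set T -> \bar R}) (P : int -> T -> Prop) :
  (forall k, {ae mu, forall u, P k u}) -> {ae mu, forall u, forall k, P k u}.
Proof.
move=> aeP.
have /(ae_foralln (mu := mu)) : forall n, \forall u \ae mu, P (Posz n) u /\ P (Negz n) u.
  by move=> n; move: (aeP (Posz n)) (aeP (Negz n)); apply: filterS2 => u; split.
by apply: filterS => u Pu [n|n]; case: (Pu n).
Qed.

Lemma measurable_nneseries {R : realType} d (T : measurableType d)
    (h : nat -> T -> \bar R) (N : nat) :
  (forall k, measurable_fun setT (h k)) -> (forall k x, 0 <= h k x)%E ->
  measurable_fun setT (fun x => \sum_(N <= k <oo) h k x)%E.
Proof.
move=> mh h0; under eq_fun do rewrite eseries_cond.
exact: (@ge0_emeasurable_sum _ T R setT h [pred k | (N <= k)%N] (fun k x _ _ => h0 k x)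
  (fun k _ => mh k)).
Qed.

Section periodization.
Context {R : realType}.
Local Notation mu := (@lebesgue_measure R).
Local Notation mR := (measurableTypeR R).

Lemma int_window_uniq (m m' : int) (x : R) :
  m%:~R <= x < m%:~R + 1 -> m'%:~R <= x < m'%:~R + 1 -> m = m'.
Proof.
have W (p q : int) : p%:~R <= x -> x < q%:~R + 1 -> p <= q.
  move=> px xq; rewrite -ltzD1 -(ltr_int R) intrD.
  exact: le_lt_trans px xq.
by move=> /andP[a b] /andP[a' b']; apply/eqP; rewrite eq_le !W.
Qed.

(** On a window [j, j + 1[, exchanging sum and integral turns the integral of
    the periodized function into a sum of integrals of [f] over the windows
    [j - phi k, j - phi k + 1[.  These are pairwise disjoint because [phi] is
    injective, so that the total is at most the integral of [f]. *)
Lemma ae_periodization_lty (f : mR -> \bar R) (phi : nat -> int) :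
  measurable_fun setT f -> (forall x, 0 <= f x)%E -> (\int[mu]_x f x < +oo)%E ->
  injective phi ->
  {ae mu, forall u : R, (\sum_(k <oo) f (u - (phi k)%:~R)%R < +oo)%E}.
Proof.
move=> mf f0 foo iphi.
pose S u := (\sum_(k <oo) f (u - (phi k)%:~R)%R)%E.
pose W (j : int) : set mR := `[(j%:~R : R), (j%:~R + 1 : R)[%classic.
have mW j : measurable (W j) by exact: measurable_itv.
have mk k : measurable_fun [set: mR] (fun u : mR => f (u - (phi k)%:~R)%R).
  by apply: measurableT_comp => //; exact: measurable_shift.
have mS : measurable_fun setT S by exact: measurable_nneseries.
have iS j : (\int[mu]_(u in W j) S u < +oo)%E.
  rewrite integral_nneseries//; last by move=> k; exact: measurable_funTS.
  have E k : (\int[mu]_(u in W j) f (u - (phi k)%:~R)%R =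
              \int[mu]_(u in W (j - phi k)%R) f u)%E.
    rewrite -[RHS](ge0_integral_shift (phi k)%:~R)//; congr (integral _ _ _).
    apply/seteqP; split=> y; rewrite /W /= !in_itv/= intrB lerD2r;
      by rewrite addrAC ltrD2r.
  under eq_eseriesr do rewrite E.
  rewrite -ge0_integral_bigcup//.
  - apply: le_lt_trans foo; apply: ge0_subset_integral => //.
    by apply: bigcupT_measurable => k.
  - exact: measurable_funTS.
  - apply/trivIsetP => k l _ _ kl; apply/eqP/negPn/negP => /set0P[x [/=]].
    rewrite /W /= !in_itv/= => xk xl; move/negP: kl; apply.
    have /(congr1 (fun z => j - z)) := int_window_uniq xk xl.
    by rewrite !subKr => /iphi ->.
have aeS j : {ae mu, forall u, W j u -> S u \is a fin_num}.
  apply: integrable_ae => //; apply/integrableP; split; first exact: measurable_funTS.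
  by under eq_integral do rewrite gee0_abs ?nneseries_ge0//.
apply: filterS (ae_forall_int aeS) => u /(_ (Num.floor u)) Su.
have : S u \is a fin_num.
  by apply: Su; rewrite /W/= in_itv/= floor_le_tmp -[X in _ + X]/(1%:~R) -intrD floorD1_gt.
by rewrite ge0_fin_numE// nneseries_ge0.
Qed.

End periodization.

(** * Partial sums of the Zak series *)

Section partial_sums.
Context {R : realType}.
Local Notation mu := (@lebesgue_measure R).
Local Notation mR := (measurableTypeR R).
Implicit Types (g : R -> R[i]) (u c : R).

(** Pairing the indices [Posz k] and [Negz k] turns the bilateral series into
    a series over the natural numbers, compatible with the indexing of
    [zak_partial]. *)
Definition zak_energy g u (k : nat) : R :=
  sqmod (g (u - (Posz k)%:~R)) + sqmod (g (u - (Negz k)%:~R)).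

Definition zak_tail g u (m : nat) : \bar R := (\sum_(m <= k <oo) (zak_energy g u k)%:E)%E.

Lemma zak_energy_ge0 g u k : (0 <= (zak_energy g u k)%:E)%E.
Proof. by rewrite lee_fin addr_ge0// sqmod_ge0. Qed.

Lemma zak_tail_ge0 g u m : (0 <= zak_tail g u m)%E.
Proof. by apply: nneseries_ge0 => *; exact: zak_energy_ge0. Qed.

Lemma ae_zak_tail_lty g : L2 g -> {ae mu, forall u, (zak_tail g u 0 < +oo)%E}.
Proof.
move=> [mg goo].
have P0 phi : injective phi -> {ae mu, forall u : R,
    (\sum_(k <oo) (sqmod (g (u - (phi k)%:~R)%R))%:E < +oo)%E}.
  apply: (ae_periodization_lty (f := fun v => (sqmod (g v))%:E)) => //.
  - exact: measurable_esqmod.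
  - by move=> v; rewrite lee_fin sqmod_ge0.
have iP : injective Posz by move=> ? ? [].
have iN : injective Negz by move=> ? ? [].
apply: ae_imply2 (P0 _ iP) (P0 _ iN) => u uP uN.
rewrite /zak_tail.
under eq_eseriesr do rewrite EFinD.
by rewrite nneseriesD ?lte_add_pinfty// => *; rewrite lee_fin sqmod_ge0.
Qed.

Lemma zak_tail_cvg0 g u : (zak_tail g u 0 < +oo)%E -> zak_tail g u m @[m --> \oo] --> 0%E.
Proof. by move=> uoo; apply: nneseries_tail_cvg => // *; exact: zak_energy_ge0. Qed.

Lemma measurable_zak_tail g m : cmeasurable (g : mR -> R[i]) ->
  measurable_fun [set: mR] (fun u : mR => zak_tail g u m).
Proof.
move=> mg; apply: measurable_nneseries => k; last by move=> *; exact: zak_energy_ge0.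
by apply/measurable_EFinP/measurable_funD; apply: measurable_sqmod;
  apply: cmeasurable_comp mg _; exact: measurable_shift.
Qed.

(** All the indices of [zak_partial _ T T]; together with [zak_mask], it lets
    partial sums of different shapes be compared coefficient by coefficient
    over a common index set. *)
Definition zak_range (T : nat) : seq int :=
  [seq Posz i | i <- index_iota 0 T] ++ [seq Negz i | i <- index_iota 0 T].

Definition zak_mask (M N : nat) (k : int) : bool :=
  match k with Posz i => (i < N)%N | Negz i => (i < M)%N end.

Lemma uniq_zak_range T : uniq (zak_range T).
Proof.
rewrite /zak_range /index_iota cat_uniq !map_inj_uniq ?iota_uniq//=; last 2 first.
- by move=> ? ? [].
- by move=> ? ? [].
by rewrite andbT; apply/hasPn => _ /mapP[j _ ->]; apply/mapP => -[].
Qed.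

Lemma big_zak_range (V : zmodType) (F : int -> V) T :
  \sum_(k <- zak_range T) F k = \sum_(k < T) (F (Posz k) + F (Negz k)).
Proof.
by rewrite /zak_range big_cat !big_map !big_mkord big_split.
Qed.

Lemma zak_partial_mask g M N T u eta : (M <= T)%N -> (N <= T)%N ->
  zak_partial g M N u eta =
  \sum_(k <- zak_range T) (zak_mask M N k)%:R * zak_term g u eta k.
Proof.
move=> MT NT; rewrite big_zak_range big_split/= /zak_partial; congr (_ + _).
- rewrite (big_ord_widen _ (fun k => zak_term g u eta (Posz k)) NT).
  by rewrite big_mkcond/=; apply: eq_bigr => k _; case: ifP; rewrite ?mul1r ?mul0r.
- rewrite (big_ord_widen _ (fun k => zak_term g u eta (Negz k)) MT).
  by rewrite big_mkcond/=; apply: eq_bigr => k _; case: ifP; rewrite ?mul1r ?mul0r.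
Qed.

Lemma sqmod_boolB (b b' : bool) : sqmod (b%:R - b'%:R : R[i]) <= 1.
Proof.
by rewrite sqmodE; case: b; case: b';
  rewrite /= ?subrr ?subr0 ?sub0r ?sqrrN ?expr1n ?expr0n ?oppr0 ?expr0n ?addr0.
Qed.

(** By Parseval's identity, the squared distance is [2 * pi] times the energy
    of the coefficients that occur in exactly one of the two sums, and these
    have index at least [m]. *)
Lemma zak_partial_dist g u c m M N M' N' :
  [&& (m <= M)%N, (m <= N)%N, (m <= M')%N & (m <= N')%N] ->
  (\int[mu]_(eta in `[c, (c + 2 * pi)%R])
    (sqmod (zak_partial g M N u eta - zak_partial g M' N' u eta))%:E
   <= (2 * pi)%:E * zak_tail g u m)%E.
Proof.
case/and4P => mM mN mM' mN'.
set T := (M + N + M' + N')%N.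
pose b (k : int) := ((zak_mask M N k)%:R - (zak_mask M' N' k)%:R) * g (u - k%:~R).
have E eta : zak_partial g M N u eta - zak_partial g M' N' u eta =
    \sum_(k <- zak_range T) b k * expi (k%:~R * eta).
  rewrite !(@zak_partial_mask g _ _ T) /T; [|lia..].
  by rewrite -sumrB; apply: eq_bigr => k _; rewrite -mulrBl /zak_term mulrA.
under eq_integral do rewrite E.
rewrite parseval ?uniq_zak_range// EFinM lee_pmul2l//; last first.
  by rewrite lte_fin mulr_gt0// pi_gt0.
rewrite big_zak_range.
have mT : (m <= T)%N by rewrite /T; lia.
apply: le_trans (nneseries_lim_ge T _); last by move=> *; exact: zak_energy_ge0.
rewrite sumEFin lee_fin -(big_mkord xpredT (fun k => sqmod (b (Posz k)) + sqmod (b (Negz k)))).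
rewrite (big_cat_nat (n := m))//= big1_seq ?add0r.
  apply: ler_sum => k _; apply: lerD; rewrite /b sqmodM ler_piMl ?sqmod_ge0//.
  - exact: sqmod_boolB.
  - exact: sqmod_boolB.
move=> k; rewrite mem_index_iota /= => km.
have [-> ->] : b k = 0 /\ b (Negz k) = 0; last by rewrite sqmod0 addr0.
by rewrite /b /zak_mask; split; rewrite !(leq_trans km)// subrr mul0r.
Qed.

End partial_sums.

(** * Limits of sequences with summable increments *)

Section limits.
Context {R : realType}.

Lemma cvg_summable_increments (x b : R^nat) :
  (forall i, `|x i.+1 - x i| <= b i) -> (\sum_(i <oo) (b i)%:E < +oo)%E ->
  cvgn x.
Proof.
move=> xb boo.
have b0 i : 0 <= b i by exact: le_trans (normr_ge0 _) (xb i).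
have cb : cvgn (series b).
  apply: nondecreasing_is_cvgn.
    by apply/nondecreasing_series => i _ _; exact: b0.
  exists (fine (\sum_(i <oo) (b i)%:E)%E) => _ [n _ <-].
  rewrite -lee_fin fineK; last first.
    by rewrite ge0_fin_numE// nneseries_ge0// => *; rewrite lee_fin.
  by rewrite /series/= -sumEFin; apply: nneseries_lim_ge => *; rewrite lee_fin.
have ct : cvgn (series (telescope x)).
  by apply: normed_cvg; apply: (series_le_cvg _ b0 xb cb) => i; exact: normr_ge0.
rewrite (_ : x = (fun n => x 0%N + series (telescope x) n)).
  by apply: is_cvgD => //; exact: is_cvg_cst.
by apply/funext => n; exact: eq_sum_telescope.
Qed.

(** A limit in the complex plane as a total function: limits superior keep it
    measurable with respect to parameters, whether or not the sequence
    converges. *)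
Definition clim (q : nat -> R[i]) : R[i] :=
  fine (limn_esup (fun i => (complex.Re (q i))%:E)) +i*
  fine (limn_esup (fun i => (complex.Im (q i))%:E)).

Lemma cvg_fine_limn_esup (x : R^nat) : cvgn x ->
  x @ \oo --> fine (limn_esup (fun i => (x i)%:E)).
Proof.
move=> cx; have xl : (fun i => (x i)%:E) @ \oo --> (limn x)%:E.
  by apply: cvg_EFin => //; exact: nearW.
by rewrite (cvg_limn_einf_sup xl).2.
Qed.

Lemma cvg_sqmodB_clim (q : nat -> R[i]) (z : R[i]) :
  cvgn (fun i => complex.Re (q i)) -> cvgn (fun i => complex.Im (q i)) ->
  (fun i => (sqmod (z - q i))%:E) @ \oo --> (sqmod (z - clim q))%:E.
Proof.
move=> cR cI; apply: cvg_EFin; first exact: nearW.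
rewrite /comp /=; under eq_fun do rewrite sqmodE ReD ImD ReN ImN.
rewrite sqmodE ReD ImD ReN ImN !expr2.
by apply: cvgD; apply: cvgM; apply: cvgB;
  (try exact: cvg_cst); exact: cvg_fine_limn_esup.
Qed.

Lemma geometric_lty : (\sum_(i <oo) ((1 / 2) ^+ i)%:E < +oo :> \bar R)%E.
Proof.
apply: (@le_lt_trans _ _ 2%:E); last exact: ltry.
apply: lime_le; first by apply: is_cvg_nneseries => *; rewrite lee_fin exprn_ge0.
apply: nearW => n; rewrite sumEFin lee_fin.
have half1 : `|1 / 2 : R| < 1 by rewrite ger0_norm; lra.
have half0 : 0 < 1 / 2 :> R by lra.
apply: le_trans (_ : 1 * (1 - 1 / 2)^-1 <= 2); last first.
  by rewrite mul1r (_ : 1 - 1 / 2 = 2^-1 :> R) ?invrK//; field.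
apply: le_trans (geometric_le_lim n ler01 half0 half1); rewrite /series/=.
by apply: ler_sum => i _; rewrite /= !mul1r.
Qed.

(** Trades an increment for its square: bounds on squared [L^2] norms control
    sums of squares, while pointwise convergence needs the sum of the
    increments themselves. *)
Lemma le_amgm (t r D : R) : 0 < t -> r ^+ 2 <= D -> `|r| <= t^-1 + t * D.
Proof.
move=> t0 rD; rewrite -(ler_pM2l t0) mulrDr mulfV ?gt_eqF//.
apply: (@le_trans _ _ (1 + t * (t * r ^+ 2))); last by rewrite lerD2l !ler_pM2l.
rewrite -(real_normK (num_real r)); have := sqr_ge0 (t * `|r| - 1).
have : 0 <= t * `|r| by rewrite mulr_ge0// ltW.
nra.
Qed.

(** By [le_amgm] with [t = 2 ^ i], the increments are bounded by the sum of a
    geometric term and of the [i]-th term of the series in the hypothesis. *)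
Lemma cvg_Re_Im_fast (q : nat -> R[i]) :
  (\sum_(i <oo) (2 ^+ i * sqmod (q i.+1 - q i))%:E < +oo)%E ->
  cvgn (fun i => complex.Re (q i)) /\ cvgn (fun i => complex.Im (q i)).
Proof.
move=> qoo; pose b i := (2 ^+ i)^-1 + 2 ^+ i * sqmod (q i.+1 - q i).
have t0 i : 0 < 2 ^+ i :> R by rewrite exprn_gt0.
have boo : (\sum_(i <oo) (b i)%:E < +oo)%E.
  under eq_eseriesr do rewrite EFinD.
  rewrite nneseriesD; last 2 first.
  - by move=> i _ _; rewrite lee_fin invr_ge0 ltW.
  - by move=> i _ _; rewrite lee_fin mulr_ge0 ?sqmod_ge0// ltW.
  apply: lte_add_pinfty => //.
  by under eq_eseriesr do rewrite -exprVn -div1r; exact: geometric_lty.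
split; apply: cvg_summable_increments boo => i; apply: le_amgm => //; rewrite sqmodE ReD ImD ReN ImN.
- by rewrite lerDl sqr_ge0.
- by rewrite lerDr sqr_ge0.
Qed.

Lemma cmeasurable_clim d (T : measurableType d) (q : nat -> T -> R[i]) :
  (forall i, cmeasurable (q i)) -> cmeasurable (fun x => clim (q ^~ x)).
Proof.
move=> mq; split => /=.
- apply: measurableT_comp; first exact: fine_measurable.
  by apply: measurable_fun_limn_esup => i; apply/measurable_EFinP; case: (mq i).
- apply: measurableT_comp; first exact: fine_measurable.
  by apply: measurable_fun_limn_esup => i; apply/measurable_EFinP; case: (mq i).
Qed.

End limits.

(** * Limits in L2 and measurable selection of an index *)

Section L2_limit.
Context {R : realType} d (T : measurableType d) (mu : {measure set T -> \bar R}).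
Context (D : set T) (mD : measurable D) (q : nat -> T -> R[i]).
Context (mq : forall i, cmeasurable (q i)).

(** The [L^2] Cauchy estimate still beats the weight [2 ^ i]: the sum of the
    functions [2 ^ i * sqmod (q i.+1 - q i)] has a finite integral, hence is
    finite almost everywhere, and [cvg_Re_Im_fast] applies. *)
Lemma ae_cvg_fast (C : R) : 0 <= C ->
  (forall i, \int[mu]_(x in D) (sqmod (q i.+1 x - q i x))%:E
             <= (C * (1 / 4) ^+ i)%:E)%E ->
  {ae mu, forall x, D x -> cvgn (fun i => complex.Re (q i x)) /\
                           cvgn (fun i => complex.Im (q i x))}.
Proof.
move=> C0 qC.
pose h i x := (2 ^+ i * sqmod (q i.+1 x - q i x))%:E.
have h0 i x : (0 <= h i x)%E.
  by rewrite /h lee_fin mulr_ge0 ?sqmod_ge0 ?exprn_ge0.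
have mh i : measurable_fun setT (h i).
  apply/measurable_EFinP/measurable_funM => //.
  by apply/measurable_sqmod; exact: cmeasurableB.
have hoo : (\int[mu]_(x in D) (\sum_(i <oo) h i x) < +oo)%E.
  rewrite integral_nneseries//; last by move=> i; exact: measurable_funTS.
  apply: (@le_lt_trans _ _ (C%:E * \sum_(i <oo) ((1 / 2) ^+ i)%:E)%E).
    rewrite -nneseriesZl; last by move=> i _; rewrite lee_fin exprn_ge0.
    apply: lee_nneseries => [i _ _|i _]; first exact: integral_ge0.
    rewrite /h; under eq_integral do rewrite EFinM.
    have mi : measurable_fun D (fun x => (sqmod (q i.+1 x - q i x))%:E).
      by apply/measurable_funTS/measurable_esqmod; exact: cmeasurableB.
    have i0 x : D x -> (0 <= (sqmod (q i.+1 x - q i x))%:E)%E.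
      by rewrite lee_fin sqmod_ge0.
    have p0 : (0 <= (2 ^+ i)%:E :> \bar R)%E by rewrite lee_fin exprn_ge0.
    rewrite (ge0_integralZl mu mD mi i0 p0).
    apply: (le_trans (lee_wpmul2l p0 (qC i))).
    rewrite -!EFinM lee_fin mulrCA -exprMn (_ : 2 * (1 / 4) = 1 / 2 :> R); last by field.
    exact: lexx.
  by rewrite lte_mul_pinfty// ?lee_fin// geometric_lty.
have : mu.-integrable D (fun x => \sum_(i <oo) h i x)%E.
  apply/integrableP; split.
    by apply: measurable_funTS; exact: measurable_nneseries.
  by under eq_integral do rewrite gee0_abs ?nneseries_ge0//.
move=> /(integrable_ae mD); apply: ae_imply => x /[apply] hx.
apply: cvg_Re_Im_fast; rewrite -ge0_fin_numE//; apply: nneseries_ge0 => *; exact: h0.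
Qed.

(** By Fatou's lemma, squared [L^2] distances can only drop in an almost
    everywhere limit; this is how that limit becomes the [L^2] limit. *)
Lemma fatou_clim (p : T -> R[i]) (B : \bar R) (e : R^nat) : cmeasurable p ->
  {ae mu, forall x, D x -> cvgn (fun i => complex.Re (q i x)) /\
                           cvgn (fun i => complex.Im (q i x))} ->
  e @ \oo --> 0 ->
  (forall i, \int[mu]_(x in D) (sqmod (p x - q i x))%:E <= B + (e i)%:E)%E ->
  (\int[mu]_(x in D) (sqmod (p x - clim (q ^~ x)))%:E <= B)%E.
Proof.
move=> mp aeq e0 qB.
pose f i x := (sqmod (p x - q i x))%:E.
have mf i : measurable_fun D (f i).
  by apply/measurable_funTS/measurable_esqmod; exact: cmeasurableB.
have f0 i x : D x -> (0 <= f i x)%E by rewrite lee_fin sqmod_ge0.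
apply: (@le_trans _ _ (\int[mu]_(x in D) limn_einf (f^~ x))%E).
  apply: ae_ge0_le_integral => //.
  - by move=> x _; rewrite lee_fin sqmod_ge0.
  - apply/measurable_funTS/measurable_esqmod/cmeasurableB => //.
    exact: cmeasurable_clim.
  - move=> x Dx; rewrite limn_einf_lim; apply: lime_ge; first exact: is_cvg_einfs.
    by apply: nearW => n; apply: le_ereal_inf_tmp => _ [k _ <-]; exact: f0.
  - rewrite /limn_einf; apply: measurableT_comp => //.
    by apply: measurable_fun_limn_esup => i; exact: measurableT_comp.
  - apply: ae_imply aeq => x /[apply] -[cR cI].
    by rewrite (cvg_limn_einf_sup (cvg_sqmodB_clim cR cI)).1.
apply: le_trans (fatou mu mD mf f0) _.
rewrite limn_einf_lim.
have cB : (fun i => B + (e i)%:E)%E @ \oo --> B.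
  rewrite -[X in _ --> X]adde0; apply: cvgeD.
  - exact: fin_num_adde_defl.
  - exact: cvg_cst.
  - by apply: cvg_EFin => //; exact: nearW.
rewrite -(cvg_lim _ cB)//; apply: lee_lim.
- exact: is_cvg_einfs.
- by apply/cvg_ex; exists B.
- by apply: nearW => n; apply: le_trans (qB n); apply: ereal_inf_lbound; exists n => /=.
Qed.

End L2_limit.

Section first_index.
Implicit Type P : nat -> bool.

(** The default value [0] makes this index depend measurably on a parameter
    even where no index satisfies [P]. *)
Definition first_index P : nat :=
  xget 0%N [set n | P n /\ forall k, (k < n)%N -> ~~ P k].

Lemma first_indexP P : (exists n, P n) -> P (first_index P).
Proof.
move=> eP; rewrite /first_index; case: xgetP => [n _ []//|].
have [n Pn nP] := ex_minnP eP; move=> /(_ n) []; split=> // k.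
by rewrite ltnNge; apply: contra => /nP.
Qed.

Lemma first_indexE P n : first_index P = n <->
  (P n /\ forall k, (k < n)%N -> ~~ P k) \/ (n = 0%N /\ forall k, ~~ P k).
Proof.
rewrite /first_index; split.
- case: xgetP => [m -> + <-|nP <-]; first by left.
  right; split=> // k; apply/negP => Pk.
  have [m Pm mP] := ex_minnP (ex_intro _ k Pk); apply: (nP m); split=> // l.
  by rewrite ltnNge; apply: contra => /mP.
- case=> [nP|[-> nP]].
    apply: xget_unique => // m [Pm mP]; case: nP => Pn nP.
    have := @mP n; have := @nP m; rewrite Pm Pn; case: ltngtP => //.
    + by move=> _ /(_ isT).
    + by move=> _ _ /(_ isT).
  by case: xgetP => // m _ [Pm]; rewrite (negbTE (nP m)) in Pm.
Qed.

Lemma measurable_first_index d (T : measurableType d) (P : nat -> T -> bool) n :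
  (forall k, measurable [set x | P k x]) ->
  measurable [set x | first_index (P ^~ x) = n].
Proof.
move=> mP.
have mnP k : measurable [set x | ~~ P k x].
  rewrite (_ : [set _ | _] = ~` [set x | P k x]); first exact: measurableC.
  by apply/seteqP; split=> x /= /negP.
rewrite (_ : [set _ | _] =
   ([set x | P n x] `&` \bigcap_(k in [set k | (k < n)%N]) [set x | ~~ P k x]) `|`
   ([set x | n = 0%N] `&` \bigcap_k [set x | ~~ P k x])).
  apply: measurableU; apply: measurableI => //.
  - by apply: bigcap_measurableType => k _; exact: mnP.
  - case: n => [|n]; first by rewrite (_ : [set _ | _] = setT)//; apply/seteqP; split.
    by rewrite (_ : [set _ | _] = set0)//; apply/seteqP; split.
  - exact: bigcapT_measurable.
apply/seteqP; split=> x /=.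
- by move/first_indexE => [[Pn nP]|[n0 nP]]; [left|right]; split=> // k ?; exact: nP.
- move=> H; apply/first_indexE; case: H => [[Pn nP]|[n0 nP]]; [left|right]; split=> // k;
    exact: nP.
Qed.

(** On each of the countably many measurable pieces where [N] is constant,
    the function is one of the [F n]. *)
Lemma measurable_fun_select {R : realType} d (T : measurableType d)
    (N : T -> nat) (F : nat -> T -> R) :
  (forall n, measurable [set x | N x = n]) ->
  (forall n, measurable_fun setT (F n)) -> measurable_fun setT (fun x => F (N x) x).
Proof.
move=> mN mF _ Y mY; rewrite setTI.
rewrite (_ : _ @^-1` _ = \bigcup_n ([set x | N x = n] `&` F n @^-1` Y)).
  apply: bigcupT_measurable => n; apply: measurableI => //.
  by rewrite -[X in measurable X]setTI; exact: mF.
by apply/seteqP; split=> [x Yx|x [n _ [/= <-]]//]; exists (N x).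
Qed.

End first_index.

(** * Existence of the Zak transform *)

Section existence.
Context {R : realType}.
Local Notation mu := (@lebesgue_measure R).
Local Notation mR := (measurableTypeR R).
Implicit Types (g : R -> R[i]) (u c : R).

Lemma cmeasurable_zak_partial g M N : cmeasurable (g : mR -> R[i]) ->
  cmeasurable (fun p : mR * mR => zak_partial g M N p.1 p.2).
Proof.
move=> mg.
have mt k : cmeasurable (fun p : mR * mR => zak_term g p.1 p.2 k).
  apply: cmeasurableM.
    apply: (cmeasurable_comp (f := fun u : mR => g (u - k%:~R))).
      by apply: cmeasurable_comp mg _; exact: measurable_shift.
    exact: measurable_fst.
  apply: cmeasurable_expi; apply: measurable_funM; first exact: measurable_cst.
  exact: measurable_snd.
by apply: cmeasurableD; apply: cmeasurable_sum.
Qed.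

Lemma cmeasurable_section (f : mR * mR -> R[i]) (u : mR) : cmeasurable f ->
  cmeasurable (fun eta : mR => f (u, eta)).
Proof. by move=> mf; apply: cmeasurable_comp mf _; exact: measurable_pair1. Qed.

Lemma cmeasurable_zak_partial_freq g u M N :
  cmeasurable (fun eta : mR => zak_partial g M N u eta).
Proof.
by apply: cmeasurableD; apply: cmeasurable_sum => k; apply: cmeasurableM;
  (try exact: cmeasurable_cst); apply: cmeasurable_expi;
  apply: measurable_funM => //; exact: measurable_cst.
Qed.

Definition zak_index g (i : nat) (u : R) : nat :=
  first_index (fun n => (zak_tail g u n <= ((1 / 4) ^+ i)%:E)%E).

Definition zak_fast g (i : nat) (u eta : R) : R[i] :=
  zak_partial g (zak_index g i u) (zak_index g i u) u eta.

(** Letting the order of the partial sums depend on [u] makes the convergence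
    geometric wherever the tails are finite, hence pointwise for almost every
    [eta]. *)
Definition zak_lim g (u eta : R) : R[i] := clim (fun i => zak_fast g i u eta).

Lemma zak_tail_index g i u : (zak_tail g u 0 < +oo)%E ->
  (zak_tail g u (zak_index g i u) <= ((1 / 4) ^+ i)%:E)%E.
Proof.
move=> uoo; apply: (first_indexP (P := fun n => (zak_tail g u n <= ((1 / 4) ^+ i)%:E)%E)).
have e0 : (0 < ((1 / 4) ^+ i)%:E :> \bar R)%E by rewrite lte_fin exprn_gt0//; lra.
have t0 := zak_tail_cvg0 uoo.
apply: contrapT => /forallNP tgt.
suff : (((1 / 4) ^+ i)%:E <= limn (zak_tail g u))%E by rewrite (cvg_lim _ t0)// leNgt e0.
apply: lime_ge; first by apply/cvg_ex; exists 0%E.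
by apply: nearW => n; have /negP := tgt n; rewrite -ltNge => /ltW.
Qed.

Lemma cmeasurable_zak_fast g i : cmeasurable (g : mR -> R[i]) ->
  cmeasurable (fun p : mR * mR => zak_fast g i p.1 p.2).
Proof.
move=> mg.
have mN n : measurable [set p : mR * mR | zak_index g i p.1 = n].
  have -> : [set p : mR * mR | zak_index g i p.1 = n] =
     fst @^-1` [set u : mR | zak_index g i u = n] by [].
  rewrite -[X in measurable X]setTI; apply: measurable_fst => //.
  apply: measurable_first_index => k.
  have -> : [set u : mR | (zak_tail g u k <= ((1 / 4) ^+ i)%:E)%E] =
      (fun u : mR => zak_tail g u k) @^-1` `]-oo, ((1 / 4) ^+ i)%:E]%classic.
    by apply/seteqP; split=> u /=; rewrite in_itv.
  rewrite -[X in measurable X]setTI; apply: (measurable_zak_tail k mg) => //.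
  exact: emeasurable_itv.
split.
- apply: (measurable_fun_select (N := fun p : mR * mR => zak_index g i p.1)
    (F := fun n p => complex.Re (zak_partial g n n p.1 p.2))) => // n.
  by case: (cmeasurable_zak_partial n n mg).
- apply: (measurable_fun_select (N := fun p : mR * mR => zak_index g i p.1)
    (F := fun n p => complex.Im (zak_partial g n n p.1 p.2))) => // n.
  by case: (cmeasurable_zak_partial n n mg).
Qed.

(** The bound of [zak_partial_dist] survives the limit by Fatou's lemma. The
    tail at [minn (minn M N) (zak_index g i u)] is at most the tail at
    [minn M N] plus [(1 / 4) ^ i], whichever index realizes the minimum. *)
Lemma zak_partial_lim_dist g u c M N : cmeasurable (g : mR -> R[i]) ->
  (zak_tail g u 0 < +oo)%E ->
  (\int[mu]_(eta in `[c, (c + 2 * pi)%R])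
    (sqmod (zak_partial g M N u eta - zak_lim g u eta))%:E
   <= (2 * pi)%:E * zak_tail g u (minn M N))%E.
Proof.
move=> mg uoo.
have mI : measurable (`[c, (c + 2 * pi)%R]%classic : set mR) by exact: measurable_itv.
have pi2 : 0 <= 2 * pi :> R by rewrite mulr_ge0// ltW// pi_gt0.
have mq i : cmeasurable (fun eta : mR => zak_fast g i u eta).
  exact: (cmeasurable_section u (cmeasurable_zak_fast i mg)).
have e0 i : (0 <= ((1 / 4) ^+ i)%:E :> \bar R)%E by rewrite lee_fin exprn_ge0//; lra.
have aeq := ae_cvg_fast (mu := mu) mI mq pi2.
apply: (fatou_clim (mu := mu) mI mq (e := fun i => 2 * pi * (1 / 4) ^+ i)).
- exact: cmeasurable_zak_partial_freq.
- apply: aeq => i.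
  pose m := minn (zak_index g i.+1 u) (zak_index g i u).
  apply: le_trans (zak_partial_dist g u c (m := m) _) _.
    by rewrite /m; apply/and4P; split; rewrite ?geq_minl ?geq_minr.
  rewrite (EFinM (2 * pi)); apply: lee_wpmul2l; rewrite ?lee_fin// /m.
  case: leqP => _; last exact: zak_tail_index.
  apply: le_trans (zak_tail_index i.+1 uoo) _.
  by rewrite lee_fin exprS ler_piMl ?exprn_ge0//; lra.
- rewrite -(mulr0 (2 * pi)); apply: cvgM; first exact: cvg_cst.
  by apply: cvg_expr; rewrite ger0_norm; lra.
- move=> i; pose m := minn (minn M N) (zak_index g i u).
  apply: le_trans (zak_partial_dist g u c (m := m) _) _.
    by rewrite /m; apply/and4P; split; rewrite !geq_min leqnn ?orbT.
  rewrite (EFinM (2 * pi)) -ge0_muleDr; [|exact: zak_tail_ge0|exact: e0].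
  apply: lee_wpmul2l; rewrite ?lee_fin// /m.
  case: (leqP (minn M N)) => _.
    by rewrite leeDl.
  by rewrite (le_trans (zak_tail_index i uoo))// leeDr// zak_tail_ge0.
Qed.

Lemma cvg_minn_oo : (fun mn : nat * nat => minn mn.1 mn.2) @ (\oo, \oo) --> \oo.
Proof.
move=> A [N _ NA]; exists ([set n | (N <= n)%N], [set n | (N <= n)%N]) => /=.
  by split; exists N.
by move=> [m n] /= [Nm Nn]; apply: NA => /=; rewrite leq_min Nm.
Qed.

(** Square integrability makes the tails of the energy tend to [0] for almost
    every [u], and they dominate the squared distances. *)
Theorem is_zak_zak_lim g : L2 g -> is_zak g (zak_lim g).
Proof.
move=> hg; have [mg _] := hg; split.
  exact: cmeasurable_clim (fun i => cmeasurable_zak_fast i mg).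
apply: ae_imply (ae_zak_tail_lty hg) => u uoo c.
have t0 : (fun mn : nat * nat => (2 * pi)%:E * zak_tail g u (minn mn.1 mn.2))%E @ (\oo, \oo) --> 0%E.
  rewrite -(mule0 (2 * pi)%:E); apply: cvgeZl => //.
  exact: (cvg_comp _ _ cvg_minn_oo (zak_tail_cvg0 uoo)).
apply: squeeze_cvge (cvg_cst 0%E) t0; apply: nearW => mn.
apply/andP; split; last exact: zak_partial_lim_dist.
by apply: integral_ge0 => eta _; rewrite lee_fin sqmod_ge0.
Qed.

End existence.

(** * Uniqueness of the Zak transform *)

Section null.
Context {R : realType}.

Lemma integral_sqmod_eq0 d (T : measurableType d) (m : {measure set T -> \bar R})
    (D : set T) (h : T -> R[i]) : measurable D -> cmeasurable h ->
  (\int[m]_(x in D) (sqmod (h x))%:E)%E = 0%E <-> {ae m, forall x, D x -> h x = 0}.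
Proof.
move=> mD mh.
have mf : measurable_fun D (fun x => (sqmod (h x))%:E).
  by apply/measurable_funTS/measurable_esqmod.
have E : (\int[m]_(x in D) (sqmod (h x))%:E = \int[m]_(x in D) `|(sqmod (h x))%:E|)%E.
  by apply: eq_integral => x _; rewrite gee0_abs// lee_fin sqmod_ge0.
rewrite E; split.
- move/(ae_eq_integral_abs m mD mf); apply: ae_imply => x /[apply] -[].
  exact: sqmod_eq0.
- move=> h0; apply/(ae_eq_integral_abs m mD mf); apply: ae_imply h0 => x /[apply] /= ->.
  by rewrite sqmod0.
Qed.

Lemma integral_sqmodB_le d (T : measurableType d) (m : {measure set T -> \bar R})
    (D : set T) (p f g : T -> R[i]) : measurable D ->
  cmeasurable p -> cmeasurable f -> cmeasurable g ->
  (\int[m]_(x in D) (sqmod (f x - g x))%:E <=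
   2%:E * (\int[m]_(x in D) (sqmod (p x - f x))%:E + \int[m]_(x in D) (sqmod (p x - g x))%:E))%E.
Proof.
move=> mD mp mf mg.
have mS (a b : T -> R[i]) : cmeasurable a -> cmeasurable b ->
    measurable_fun D (fun x => (sqmod (a x - b x))%:E).
  by move=> ma mb; apply/measurable_funTS/measurable_esqmod; exact: cmeasurableB.
have S0 (z : R[i]) : (0 <= (sqmod z)%:E)%E by rewrite lee_fin sqmod_ge0.
rewrite -ge0_integralD//; [|exact: mS..].
rewrite -ge0_integralZl//; last 2 first.
- by apply: emeasurable_funD; exact: mS.
- by move=> x _; exact: adde_ge0.
apply: ge0_le_integral => //; first exact: mS.
- by apply: measurable_funeM; apply: emeasurable_funD; exact: mS.
- move=> x _; rewrite -EFinD -EFinM lee_fin.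
  rewrite (_ : f x - g x = - (p x - f x) + (p x - g x)); last by ring.
  by rewrite (le_trans (sqmodD_le _ _))// sqmodN.
Qed.

End null.

Section uniqueness.
Context {R : realType}.
Local Notation mu := (@lebesgue_measure R).
Local Notation mR := (measurableTypeR R).

(** Both functions are limits of the same partial sums, so that the integral
    of [sqmod (Z - Z')] over each period vanishes for almost every [u]; the
    periods starting at integers cover the line. *)
Lemma is_zak_unique (f : R -> R[i]) (Z Z' : R -> R -> R[i]) :
  is_zak f Z -> is_zak f Z' ->
  {ae (mu \x mu)%E, forall p : mR * mR, Z p.1 p.2 = Z' p.1 p.2}.
Proof.
move=> [mZ cZ] [mZ' cZ'].
pose h (p : mR * mR) := Z p.1 p.2 - Z' p.1 p.2.
have mh : cmeasurable h by exact: cmeasurableB.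
suff h0 : (\int[(mu \x mu)%E]_p (sqmod (h p))%:E = 0)%E.
  have /(integral_sqmod_eq0 _ measurableT mh) := h0.
  by apply: ae_imply => p /(_ I) /eqP; rewrite subr_eq0 => /eqP.
rewrite fubini_tonelli1//; last 2 first.
- exact: measurable_esqmod.
- by move=> p; rewrite lee_fin sqmod_ge0.
have aeu : {ae mu, forall u : mR, (\int[mu]_eta (sqmod (h (u, eta)))%:E = 0)%E}.
  apply: ae_imply2 cZ cZ' => u cu cu'.
  have mhu := cmeasurable_section u mh.
  apply/(integral_sqmod_eq0 _ measurableT mhu).
  have W (k : int) : {ae mu, forall eta : mR,
      `[(k%:~R : R), (k%:~R + 2 * pi)%R]%classic eta -> h (u, eta) = 0}.
    have mI : measurable (`[(k%:~R : R), (k%:~R + 2 * pi)%R]%classic : set mR).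
      exact: measurable_itv.
    apply/(integral_sqmod_eq0 _ mI mhu)/eqP; rewrite eq_le; apply/andP; split; last first.
      by apply: integral_ge0 => *; rewrite lee_fin sqmod_ge0.
    have c1 := cvgeD (isT : ((0 : \bar R) +? 0)%E) (cu k%:~R) (cu' k%:~R).
    have := cvgeZl (isT : (2%:E : \bar R) \is a fin_num) (c1 _); rewrite adde0 mule0 => c2.
    apply: (cvge_ge _ (c2 _)); apply: nearW => mn.
    apply: integral_sqmodB_le => //.
    + exact: cmeasurable_zak_partial_freq.
    + exact: (cmeasurable_section u mZ).
    + exact: (cmeasurable_section u mZ').
  apply: ae_imply (ae_forall_int W) => eta /(_ (Num.floor eta)) + _; apply.
  (* A period starting at the floor of eta contains eta because 1 <= 2 * pi. *)
  rewrite /= in_itv/= floor_le_tmp/=.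
  apply: le_trans (ltW (floorD1_gt eta)) _; rewrite intrD lerD2l.
  by have := pi_ge2 R; lra.
transitivity (\int[mu]_(x in [set: mR]) (cst 0 x : \bar R))%E; last exact: integral0.
apply: ae_eq_integral => //.
- have m1 := measurable_esqmod mh.
  have p0 p : (0 <= (sqmod (h p))%:E)%E by rewrite lee_fin sqmod_ge0.
  exact: measurable_fun_fubini_tonelli_F.
- by apply: ae_imply aeu => u /= + _.
Qed.

End uniqueness.

(** * Superoscillating modulation *)

Section superoscillation.
Context {R : realType}.
Local Notation mu := (@lebesgue_measure R).
Local Notation mR := (measurableTypeR R).

(** Each exponential [expi (w * (u - k))] splits as
    [expi (w * u) * expi (- w * k)], and the second factor shifts the
    frequency variable by [w]. *)
Lemma zak_partial_superosc n a (g : R -> R[i]) x M N u eta :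
  zak_partial (superosc_window n a g x) M N u eta =
  \sum_(j < n.+1) (superosc_coef n a j)%:C * expi (superosc_freq n j * u)
     * zak_partial g M N (u - x) (eta - superosc_freq n j).
Proof.
have T k : zak_term (superosc_window n a g x) u eta k =
  \sum_(j < n.+1) (superosc_coef n a j)%:C * expi (superosc_freq n j * u)
     * zak_term g (u - x) (eta - superosc_freq n j) k.
  rewrite /zak_term /superosc_window /superosc -mulrA mulr_suml.
  apply: eq_bigr => j _; rewrite (addrAC u).
  set w := superosc_freq n j; set G := g _.
  have E : expi (w * (u - k%:~R)) * expi (k%:~R * eta) =
           expi (w * u) * expi (k%:~R * (eta - w)) :> R[i].
    by rewrite -!expiD; congr expi; ring.
  by rewrite -mulrA (mulrCA _ G) E -mulrA (mulrCA G).
rewrite /zak_partial; under eq_bigr do rewrite T.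
under [X in _ + X]eq_bigr do rewrite T.
rewrite exchange_big [X in _ + X]exchange_big -big_split /=.
by apply: eq_bigr => j _; rewrite -!mulr_sumr -mulrDr.
Qed.

(** By [zak_partial_superosc], the error of the partial sums is a fixed linear
    combination of errors of the partial sums of [g], read at [u - x] on the
    translated intervals starting at [c - superosc_freq n j]. *)
Lemma is_zak_superosc n a (g : R -> R[i]) x (Z : R -> R -> R[i]) : is_zak g Z ->
  is_zak (superosc_window n a g x) (fun u eta =>
    \sum_(j < n.+1) (superosc_coef n a j)%:C * expi (superosc_freq n j * u)
       * Z (u - x) (eta - superosc_freq n j)).
Proof.
move=> [mZ cZ]; split.
  apply: cmeasurable_sum => j; apply: cmeasurableM.
    apply: cmeasurableM; first exact: cmeasurable_cst.
    apply: cmeasurable_expi; apply: measurable_funM; first exact: measurable_cst.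
    exact: measurable_fst.
  apply: (cmeasurable_comp (h := fun p : mR * mR => (p.1 - x, p.2 - superosc_freq n j) : mR * mR) mZ).
  apply: measurable_fun_pair.
    by apply: measurable_funB; [exact: measurable_fst|exact: measurable_cst].
  by apply: measurable_funB; [exact: measurable_snd|exact: measurable_cst].
apply: ae_imply (ae_shift x cZ) => u cu c.
pose w (j : 'I_n.+1) := superosc_freq n j : R.
pose D (mn : nat * nat) (eta : mR) :=
  zak_partial g mn.1 mn.2 (u - x) eta - Z (u - x) eta.
pose K (j : 'I_n.+1) : R :=
  2 ^+ n.+1 * sqmod ((superosc_coef n a j)%:C * expi (w j * u)).
have K0 j : (0 <= (K j)%:E)%E by rewrite lee_fin mulr_ge0 ?sqmod_ge0 ?exprn_ge0.
have mD mn : cmeasurable (D mn).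
  apply: cmeasurableB; first exact: cmeasurable_zak_partial_freq.
  exact: (cmeasurable_section (u - x) mZ).
have D0 mn eta : (0 <= (sqmod (D mn eta))%:E)%E by rewrite lee_fin sqmod_ge0.
have mDs mn j : measurable_fun setT (fun eta : mR => (sqmod (D mn (eta - w j)))%:E).
  apply: (measurableT_comp (measurable_esqmod (mD mn))); exact: measurable_shift.
pose B (mn : nat * nat) := (\sum_(j < n.+1) (K j)%:E *
  \int[mu]_(eta in `[(c - w j)%R, (c - w j + 2 * pi)%R]) (sqmod (D mn eta))%:E)%E.
have B0 : B @ (\oo, \oo) --> 0%E.
  rewrite (_ : 0%E = \sum_(j < n.+1) (K j)%:E * 0)%E; last first.
    by rewrite big1// => j _; rewrite mule0.
  apply: cvg_nnesum => j _.
    by apply: nearW => mn; rewrite mule_ge0// integral_ge0.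
  by apply: cvgeZl => //; exact: cu.
apply: squeeze_cvge (cvg_cst 0%E) B0; apply: nearW => mn; apply/andP; split.
  by apply: integral_ge0 => eta _; rewrite lee_fin sqmod_ge0.
have mI : measurable (`[c, (c + 2 * pi)%R]%classic : set mR) by exact: measurable_itv.
apply: (@le_trans _ _ (\int[mu]_(eta in `[c, (c + 2 * pi)%R])
    \sum_(j < n.+1) (K j)%:E * (sqmod (D mn (eta - w j)%R))%:E)%E).
  apply: ge0_le_integral => //.
  - by move=> eta _; rewrite lee_fin sqmod_ge0.
  - apply/measurable_funTS/measurable_esqmod/cmeasurableB.
      exact: cmeasurable_zak_partial_freq.
    apply: cmeasurable_sum => j; apply: cmeasurableM; first exact: cmeasurable_cst.
    apply: (cmeasurable_comp (f := fun eta : mR => Z (u - x) eta)).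
      exact: (cmeasurable_section (u - x) mZ).
    exact: measurable_shift.
  - apply: emeasurable_sum => j; apply: measurable_funeM.
    exact: measurable_funTS.
  - move=> eta _; rewrite zak_partial_superosc -sumrB.
    under [X in (_ <= X)%E]eq_bigr do rewrite -EFinM.
    rewrite sumEFin lee_fin (le_trans (sqmod_sum_le _))// mulr_sumr.
    by apply: ler_sum => j _; rewrite -mulrBr sqmodM mulrA.
rewrite ge0_integral_sum//; last 2 first.
- by move=> j; apply: measurable_funeM; exact: measurable_funTS.
- by move=> j eta _; rewrite mule_ge0.
apply: lee_sum => j _; rewrite ge0_integralZl//; last exact: measurable_funTS.
rewrite (ge0_integral_itv_shift (w j) c (c + 2 * pi) (measurable_esqmod (mD mn)) (D0 mn)).
by rewrite addrAC.
Qed.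

End superoscillation.

Theorem theorem6p7 (R : realType) (a : R) (n : nat) (g : R -> R[i]) (x : R)
    (ha : 1 < a) (hn : (1 <= n)%N) (hg : L2 g) :
  {ae (@lebesgue_measure R \x @lebesgue_measure R)%E, forall p : R * R,
    zak (superosc_window n a g x) p.1 p.2 =
    \sum_(j < n.+1) (superosc_coef n a j)%:C * expi (superosc_freq n j * p.1)
                    * zak g (p.1 - x) (p.2 - superosc_freq n j)}.
Proof.
have zg : is_zak g (zak g) by apply: xgetPex; exists (zak_lim g); exact: is_zak_zak_lim.
have zS := is_zak_superosc n a x zg.
have zkS : is_zak (superosc_window n a g x) (zak (superosc_window n a g x)).
  by apply: xgetPex; eexists; exact: zS.
exact: (is_zak_unique zkS zS).
Qed.
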